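(* Let the possibility area $X\subseteq\mathbb{R}^n$ be continuous and bounded, let the true target location be $x_0\in X$, and let the target distribution be uniform on $X$ (so $X$ is measurable with volume $V_X=\int_X1\,dx\in(0,\infty)$ and $\pi(x)=1/V_X$ for every $x\in X$). Let $E$ be a cumulative effort function, and suppose the detection function $d:X\times\mathbb{R}_+\to[0,1]$ is regular and homogeneous. Let $\varphi^\star$ be the uniformly optimal search plan for the target distribution within $\Phi(E)$, given by the formula $\varphi^\star(x,t)=q_x^{-1}(Q^{-1}(E(t)))$ specified in the context. Then $$P[\varphi^\star(\cdot,t)]=P^{\#}[\varphi^\star(\cdot,t)]\quad\text{for all } t\ge 0,$$ and $\mu(\varphi^\star)=\mu^{\#}(\varphi^\star)$.
   Context: Notation: $\mathbb{R}_+=[0,\infty)$. A single stationary target is at an unknown point of $\mathbb{R}^n$ ($n$ a positive integer); $x_0$ denotes its true location. The target distribution is a probability distribution with density $\pi$, and its support $X$ is the possibility area; the continuous case means $X$ is uncountable and effort is allocated continuously, via effort densities. An allocation on $X$ is an (integrable) function $f:X\to\mathbb{R}_+$, where $\int_A f(x)\,dx$ is the effort placed in $A\subseteq X$. The cost of an allocation equals its total effort $\int_X f(x)\,dx$ (cost function $c(x,y)=y$). A detection function is a function $d:X\times\mathbb{R}_+\to[0,1]$, where $d(x,y)$ is the conditional probability of detecting the target when the effort density at $x$ is $y$, given that the target is at $x$. It is regular if for all $x\in X$ one has $d(x,0)=0$ and $y\mapsto\partial d(x,y)/\partial y$ is continuous, positive and strictly decreasing on $\mathbb{R}_+$ (one-sided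 derivative at $y=0$). It is homogeneous if $d(x,y)$ does not depend on $x$. For an allocation $f$, the subjective probability of detection is $P[f]=\int_X d(x,f(x))\pi(x)\,dx$, and the true probability of detection is $P^{\#}[f]=d(x_0,f(x_0))$. A search plan is a function $\varphi:X\times\mathbb{R}_+\to\mathbb{R}_+$ such that $\varphi(\cdot,t)$ is an allocation for every $t\ge0$ and $\varphi(x,\cdot)$ is increasing (i.e. nondecreasing) for every $x\in X$. A cumulative effort function is an increasing (nondecreasing) function $E:\mathbb{R}_+\to\mathbb{R}_+$ with $E(t)>0$ for all $t>0$. $\Phi(E)$ is the set of search plans $\varphi$ with $\int_X\varphi(x,t)\,dx=E(t)$ for all $t\ge0$. A plan $\varphi^\star\in\Phi(E)$ is uniformly optimal for the target distribution within $\Phi(E)$ if $P[\varphi^\star(\cdot,t)]=\max\{P[\varphi(\cdot,t)]:\varphi\in\Phi(E)\}$ for all $t\ge0$. For a regular detection function, a uniformly optimal plan within $\Phi(E)$ is given as follows (a known result), and ''the uniformly optimal search plan'' means this one. Put $q_x(y)=\pi(x)\,\partial d(x,y)/\partial y$ for $x\in X$, $y\ge0$. For $\lambda>0$ let $q_x^{-1}(\lambda)$ be the value at $\lambda$ of the inverse function of $q_x$ if $0<\lambda\le q_x(0)$, and $q_x^{-1}(\lambda)=0$ if $\lambda>q_x(0)$. Put $Q(\lambda)=\int_X q_x^{-1}(\lambda)\,dx$ and, for $K>0$, let $Q^{-1}(K)$ be the $\lambda>0$ with $Q(\lambda)=K$. Then $\varphi^\star(x,t)=q_x^{-1}(Q^{-1}(E(t)))$,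 with the convention $\varphi^\star(x,t)=0$ if $E(t)=0$. The subjective and true mean times to detection, as elements of $[0,\infty]$, are $$\mu(\varphi)=\int_0^\infty(1-P[\varphi(\cdot,t)])\,dt,\qquad \mu^{\#}(\varphi)=\int_0^\infty(1-P^{\#}[\varphi(\cdot,t)])\,dt.$$ *)

(* Defs.v *)
From HB Require Import structures.
From mathcomp Require Import all_boot all_order all_algebra.
From mathcomp Require Import all_classical all_reals all_analysis.
From mathcomp Require Import ring lra measurable_realfun.

Set Implicit Arguments.
Unset Strict Implicit.
Unset Printing Implicit Defensive.

Import Order.TTheory GRing.Theory Num.Theory.
Import numFieldNormedType.Exports.

Local Open Scope classical_set_scope.
Local Open Scope ring_scope.

Section lebesgue_measure_Rn.
Context (R : realType) (n : nat).

(* The box ]a_0, b_0[ x ... x ]a_n, b_n[ of R^(n+1), with p = (a, b). *)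
Definition box (p : 'rV[R]_n.+1 * 'rV[R]_n.+1) : set 'rV[R]_n.+1 :=
  [set x | forall i, p.1 0 i < x 0 i < p.2 0 i].

Definition box_volume (p : 'rV[R]_n.+1 * 'rV[R]_n.+1) : R :=
  \prod_(i < n.+1) Num.max 0 (p.2 0 i - p.1 0 i).

Local Open Scope ereal_scope.

Definition lebesgue_outer (A : set 'rV[R]_n.+1) : \bar R :=
  ereal_inf [set \sum_(0 <= k <oo) (box_volume (B k))%:E |
             B in [set B : nat -> 'rV[R]_n.+1 * 'rV[R]_n.+1 |
                   A `<=` \bigcup_k box (B k)]].

Lemma box_volume_ge0 p : (0 <= box_volume p)%R.
Proof. by apply: prodr_ge0 => i _; rewrite le_max lexx. Qed.

Let vol p := (box_volume p)%:E.
Let vol_ge0 p : 0 <= vol p. Proof. by rewrite lee_fin box_volume_ge0. Qed.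

Lemma lebesgue_outer_ge0 A : 0 <= lebesgue_outer A.
Proof.
apply: le_ereal_inf_tmp => x [B _ <-{x}].
by apply: nneseries_ge0 => k _ _; exact: vol_ge0.
Qed.

Lemma lebesgue_outer0 : lebesgue_outer set0 = 0.
Proof.
apply/eqP; rewrite eq_le; apply/andP; split; last exact: lebesgue_outer_ge0.
apply: ereal_inf_lbound; exists (fun=> (0%R, 0%R)); first by [].
apply: eseries0 => k _ _.
by rewrite /box_volume big_ord_recl/= !mxE subrr maxxx mul0r.
Qed.

Lemma le_lebesgue_outer : {homo lebesgue_outer : A B / A `<=` B >-> A <= B}.
Proof.
move=> A B AB; apply/ereal_inf_le_tmp => x [C BC <-{x}].
by exists C => //; exact: subset_trans AB BC.
Qed.

Lemma lebesgue_outer_sigma_subadditive : sigma_subadditive lebesgue_outer.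
Proof.
move=> A; have [[i ioo]|] := pselect (exists i, lebesgue_outer (A i) = +oo).
  rewrite (eseries_pinfty _ _ ioo) ?leey// => k _.
  by rewrite -ltNye (lt_le_trans _ (lebesgue_outer_ge0 _)).
rewrite -forallNE => Aoo.
suff add2e (e : {posnum R}) : lebesgue_outer (\bigcup_k A k) <=
    \sum_(i <oo) lebesgue_outer (A i) + e%:num%:E.
  by apply/lee_addgt0Pr => _/posnumP[].
rewrite (le_trans _ (epsilon_trick _ _ _))//; last first.
  by move=> k; exact: lebesgue_outer_ge0.
pose P k (B : nat -> 'rV[R]_n.+1 * 'rV[R]_n.+1) :=
  (A k `<=` \bigcup_j box (B j)) /\
  \sum_(j <oo) vol (B j) <=
    lebesgue_outer (A k) + (e%:num / (2 ^ k.+1)%:R)%:E.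
have [G PG] : {G & forall k, P k (G k)}.
  apply: (@choice _ _ P) => k; rewrite /P /lebesgue_outer.
  set S := (X in ereal_inf X); move infS : (ereal_inf S) => iS.
  case: iS infS => [r Sr|Soo|Soo].
  - have en1 : (0 < e%:num / (2 ^ k.+1)%:R)%R by [].
    have /(lb_ereal_inf_adherent en1) : ereal_inf S \is a fin_num by rewrite Sr.
    move=> [x [B AB volB] xS].
    by exists B; split => //; rewrite volB -Sr; exact/ltW.
  - by have := Aoo k; rewrite /lebesgue_outer Soo.
  - suff : lbound S 0 by move/le_ereal_inf_tmp; rewrite Soo.
    by move=> /= _ [B _ <-]; apply: nneseries_ge0 => j _ _; exact: vol_ge0.
have volG_ge0 x : 0 <= (vol \o uncurry G) x by exact: vol_ge0.
apply: (@le_trans _ _ (\esum_(i in setT) (vol \o uncurry G) i)).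
  rewrite /lebesgue_outer; apply: ereal_inf_lbound => /=.
  have /card_esym/ppcard_eqP[f] := card_nat2.
  exists (uncurry G \o f).
    move=> t [i _ Ait]; have [j _ Bijt] := (PG i).1 _ Ait.
    by exists (f^-1%FUN (i, j)) => //=; rewrite invK ?inE.
  rewrite -(esum_pred_image (vol \o uncurry G) _ xpredT) ?[fun=> _]set_true//.
  by rewrite image_eq.
rewrite (_ : esum _ _ = \sum_(i <oo) \sum_(j <oo ) vol (G i j)); last first.
  pose J : nat -> set (nat * nat) := fun i => [set (i, j) | j in setT].
  rewrite (_ : setT = \bigcup_k J k); last first.
    by rewrite predeqE => -[a b]; split => // _; exists a => //; exists b.
  rewrite esum_bigcupT /=; last 2 first.
    - apply/trivIsetP => i j _ _ ij.
      rewrite predeqE => -[k m] /=; split => //= -[] [_] _ [<-{k} _].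
      by move=> [m' _] [] /esym/eqP; rewrite (negbTE ij).
    - by move=> /= [k m]; exact: vol_ge0.
  rewrite -(image_id [set: nat]) -fun_true esum_pred_image//; last first.
    by move=> k _; exact: esum_ge0.
  apply: eq_eseriesr => /= j _.
  rewrite -(esum_pred_image (vol \o uncurry G) (pair j) predT)//=; last first.
    by move=> ? ? _ _; exact: (@can_inj _ _ _ snd).
  by congr esum; rewrite predeqE => -[a b]; split; move=> [i _ <-]; exists i.
apply: lee_lim.
- apply: is_cvg_nneseries => k *.
  by apply: nneseries_ge0 => m *; exact: (volG_ge0 (k, m)).
- apply: is_cvg_nneseries => k *; apply: adde_ge0 => //.
  exact: lebesgue_outer_ge0.
- by near=> k; apply: lee_sum => i _; exact: (PG i).2.
Unshelve. all: by end_near. Qed.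

HB.instance Definition _ := isOuterMeasure.Build R 'rV[R]_n.+1 lebesgue_outer
  lebesgue_outer0 lebesgue_outer_ge0 le_lebesgue_outer
  lebesgue_outer_sigma_subadditive.

End lebesgue_measure_Rn.

Section Rn.
Context (R : realType) (n : nat).
Let mu : {outer_measure set 'rV[R]_n.+1 -> \bar R} := @lebesgue_outer R n.

(* R^(n+1) with the Lebesgue measurable sets (the Caratheodory measurable sets
   of the Lebesgue outer measure) and the topology and norm of 'rV[R]_n.+1. *)
Definition Rn : Type := caratheodory_type mu.

HB.instance Definition _ := NormedModule.copy Rn 'rV[R]_n.+1.
HB.instance Definition _ := Measurable.copy Rn (caratheodory_type mu).

Definition lebesgue_Rn : set Rn -> \bar R := mu.

HB.instance Definition _ := isMeasure.Build _ Rn R lebesgue_Rn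
  (@caratheodory_measure0 R 'rV[R]_n.+1 mu)
  (@caratheodory_measure_ge0 R 'rV[R]_n.+1 mu)
  (@caratheodory_measure_sigma_additive R 'rV[R]_n.+1 mu).

End Rn.

Section search.
Context (R : realType) (n : nat).
Implicit Types (X : set (Rn R n)) (pi f : Rn R n -> R) (d : Rn R n -> R -> R).
Implicit Types (phi : Rn R n -> R -> R) (E : R -> R).

Let vol := @lebesgue_Rn R n.

(* Functions on X, on R_+ and on X x R_+ are represented by total functions,
   whose values outside of these sets never matter. *)
Definition Rplus : set R := [set y | 0 <= y].

(* dg/dy(y) for g : R_+ -> R, one-sided at y = 0: the difference quotient is
   only taken at points of R_+. *)
Definition diff_quotient (g : R -> R) (y z : R) : R := (g z - g y) / (z - y).

Definition derivable_Rplus (g : R -> R) (y : R) : Prop :=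
  cvg (diff_quotient g y @ within Rplus (dnbhs y)).

Definition derive_Rplus (g : R -> R) (y : R) : R :=
  lim (diff_quotient g y @ within Rplus (dnbhs y)).

Definition detection_function X d : Prop :=
  forall x y, X x -> Rplus y -> 0 <= d x y <= 1.

Definition regular X d : Prop :=
  forall x, X x ->
    [/\ d x 0 = 0,
        forall y, Rplus y -> derivable_Rplus (d x) y,
        {within Rplus, continuous (derive_Rplus (d x))},
        forall y, Rplus y -> 0 < derive_Rplus (d x) y &
        forall y z, Rplus y -> Rplus z -> y < z ->
          derive_Rplus (d x) z < derive_Rplus (d x) y].

Definition homogeneous X d : Prop :=
  forall x x' y, X x -> X x' -> Rplus y -> d x y = d x' y.

Definition uniform_density X : Rn R n -> R :=
  fun x => \1_X x / fine (vol X).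

Definition allocation X f : Prop :=
  (forall x, X x -> 0 <= f x) /\ vol.-integrable X (EFin \o f).

(* P[f] and P#[f]. *)
Definition subjective_detection X pi d f : \bar R :=
  (\int[vol]_(x in X) (d x (f x) * pi x)%:E)%E.

Definition true_detection (x0 : Rn R n) d f : \bar R := (d x0 (f x0))%:E.

Definition search_plan X phi : Prop :=
  (forall t, Rplus t -> allocation X (phi ^~ t)) /\
  (forall x s t, X x -> Rplus s -> Rplus t -> s <= t -> phi x s <= phi x t).

Definition cumulative_effort E : Prop :=
  [/\ forall t, Rplus t -> Rplus (E t),
      forall s t, Rplus s -> Rplus t -> s <= t -> E s <= E t &
      forall t, 0 < t -> 0 < E t].

(* The set Phi(E). *)
Definition search_plans X E : set (Rn R n -> R -> R) :=
  [set phi | search_plan X phi /\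
    forall t, Rplus t -> (\int[vol]_(x in X) (phi x t)%:E)%E = (E t)%:E].

Definition uniformly_optimal X pi d E phi : Prop :=
  search_plans X E phi /\
  forall t psi, Rplus t -> search_plans X E psi ->
    (subjective_detection X pi d (psi ^~ t) <=
     subjective_detection X pi d (phi ^~ t))%E.

Definition rate pi d (x : Rn R n) (y : R) : R := pi x * derive_Rplus (d x) y.

(* q_x^-1(lambda), for lambda > 0. *)
Definition rate_inv pi d (x : Rn R n) (lambda : R) : R :=
  if lambda <= rate pi d x 0 then
    xget 0 [set y | Rplus y /\ rate pi d x y = lambda]
  else 0.

(* Q(lambda) *)
Definition total_rate_inv X pi d (lambda : R) : \bar R :=
  (\int[vol]_(x in X) (rate_inv pi d x lambda)%:E)%E.

(* Q^-1(K), for K > 0. *)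
Definition multiplier X pi d (K : R) : R :=
  xget 0 [set lambda | 0 < lambda /\ total_rate_inv X pi d lambda = K%:E].

Definition optimal_plan X pi d E : Rn R n -> R -> R :=
  fun x t => if E t == 0 then 0
             else rate_inv pi d x (multiplier X pi d (E t)).

(* mu(phi) and mu#(phi). *)
Definition subjective_mean_time X pi d phi : \bar R :=
  (\int[lebesgue_measure]_(t in Rplus)
     (1 - subjective_detection X pi d (phi ^~ t)))%E.

Definition true_mean_time (x0 : Rn R n) d phi : \bar R :=
  (\int[lebesgue_measure]_(t in Rplus) (1 - true_detection x0 d (phi ^~ t)))%E.

End search.

Unset Implicit Arguments.

Section regular_function.
Context (R : realType) (g : R -> R).
Hypothesis g_derivable : forall y, Rplus y -> derivable_Rplus g y.
Hypothesis dg_gt0 : forall y, Rplus y -> 0 < derive_Rplus g y.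
Hypothesis dg_decr : forall y z, Rplus y -> Rplus z -> y < z ->
  derive_Rplus g z < derive_Rplus g y.

Let diff_quotient_near (y : R) : Rplus y -> forall e : R, 0 < e ->
  exists2 r : R, 0 < r & forall z, Rplus z -> `|y - z| < r -> z != y ->
    `|derive_Rplus g y - diff_quotient g y z| < e.
Proof.
move=> y0 e e0; have /cvgrPdist_lt /(_ e e0) := g_derivable y y0.
rewrite near_withinE near_withinE => /nbhs_ballP[r /= r0 yr].
by exists r => // z z0 zr zy; exact: yr.
Qed.

Let is_derive_g (y : R) : 0 < y -> is_derive y 1 g (derive_Rplus g y).
Proof.
move=> y0; suff h : h^-1 *: ((g \o shift y) (h *: 1) - g y) @[h --> 0^'] -->
    derive_Rplus g y.
  by apply: DeriveDef; [apply/cvg_ex; eexists; exact: h | exact: cvg_lim h].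
apply/cvgrPdist_lt => e e0.
have [r r0 yr] := diff_quotient_near y (ltW y0) e e0.
rewrite near_withinE; apply/nbhs_ballP; exists (Num.min r y) => /=.
  by rewrite lt_min r0.
move=> h; rewrite /ball/= sub0r normrN lt_min => /andP[hr hy] h0.
have := yr (h + y); rewrite /diff_quotient addrK.
rewrite /GRing.scale/= mulr1 mulrC; apply.
- by rewrite /Rplus/=; move: hy; rewrite ltr_norml => /andP[]; lra.
- by rewrite opprD addrCA subrr addr0 normrN.
- by rewrite -subr_eq0 addrK.
Qed.

Let continuous_g : {within @Rplus R, continuous g}.
Proof.
apply/subspace_continuousP => y y0; apply/cvgrPdist_lt => e e0.
have [r r0 yr] := diff_quotient_near y y0 1 ltr01.
pose M := derive_Rplus g y + 1.
have M0 : 0 < M by rewrite addr_gt0// dg_gt0.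
rewrite near_withinE; apply/nbhs_ballP; exists (Num.min r (e / M)) => /=.
  by rewrite lt_min r0 divr_gt0.
move=> z; rewrite /ball/= lt_min => /andP[zr ze] z0.
have [->|zy] := eqVneq z y; first by rewrite subrr normr0.
have := yr z z0 zr zy; rewrite ltr_norml => /andP[q1 q2].
have zy0 : z - y != 0 by rewrite subr_eq0.
have -> : g y - g z = diff_quotient g y z * (y - z).
  by rewrite /diff_quotient; field.
rewrite normrM (@le_lt_trans _ _ (M * `|y - z|))//.
  rewrite ler_wpM2r// ler_norml /M.
  by move: (dg_gt0 y y0) q1 q2; lra.
by rewrite mulrC -ltr_pdivlMr.
Qed.

Let subset_Rplus (a b : R) : 0 <= a -> `[a, b] `<=` @Rplus R.
Proof. by move=> a0 x /=; rewrite in_itv/= => /andP[/(le_trans a0)]. Qed.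

Let mvt (a b : R) : 0 <= a -> a < b ->
  exists2 c, a < c < b & g b - g a = derive_Rplus g c * (b - a).
Proof.
move=> a0 ab; have [||c] := @MVT _ g (derive_Rplus g) a b ab.
- move=> x; rewrite in_itv/= => /andP[ax _].
  by apply: is_derive_g; exact: le_lt_trans ax.
- exact: continuous_subspaceW (subset_Rplus _ _ a0) continuous_g.
- by rewrite in_itv/=; exists c.
Qed.

Lemma le_tangent (y c : R) : 0 <= y -> 0 <= c ->
  g y <= g c + derive_Rplus g c * (y - c).
Proof.
move=> y0 c0; have [yc|cy|->] := ltgtP y c; last by rewrite subrr mulr0 addr0.
- have [z /andP[yz zc] gE] := mvt y c y0 yc.
  have dd := dg_decr z c (le_trans y0 (ltW yz)) c0 zc.
  have -> : g y = g c - derive_Rplus g z * (c - y) by rewrite -gE; ring.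
  by nra.
- have [z /andP[cz zy] gE] := mvt c y c0 cy.
  have dd := dg_decr c z c0 (le_trans c0 (ltW cz)) cz.
  have -> : g y = g c + derive_Rplus g z * (y - c) by rewrite -gE; ring.
  by nra.
Qed.

Lemma measurable_Rplus_g : measurable_fun (@Rplus R) g.
Proof.
apply: measurable_realfun.subspace_continuous_measurable_fun => //.
have -> : @Rplus R = `[0, +oo[%classic.
  by apply/seteqP; split => x; rewrite /Rplus/= in_itv/= andbT.
exact: measurable_itv.
Qed.

Lemma derive_Rplus_inj (y z : R) : 0 <= y -> 0 <= z ->
  derive_Rplus g y = derive_Rplus g z -> y = z.
Proof.
move=> y0 z0 e; have [yz|zy|//] := ltgtP y z.
- by have := dg_decr y z y0 z0 yz; rewrite e ltxx.
- by have := dg_decr z y z0 y0 zy; rewrite e ltxx.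
Qed.
End regular_function.

Section optimal_plan_optimal.
Context (R : realType) (n : nat) (X : set (Rn R n)) (x0 : Rn R n)
    (d : Rn R n -> R -> R) (E : R -> R)
    (X_measurable : measurable X)
    (X_volume : (0 < lebesgue_Rn X < +oo)%E)
    (X_x0 : X x0)
    (E_effort : cumulative_effort E)
    (d_detection : detection_function X d)
    (d_regular : regular X d) (d_homogeneous : homogeneous X d).
Let V := fine (lebesgue_Rn X).
Let pi := uniform_density X.
Let g := d x0.
Let phi := optimal_plan X pi d E.

Let V_E : lebesgue_Rn X = V%:E.
Proof. by rewrite fineK// ge0_fin_numE ?(andP X_volume).2// ltW ?(andP X_volume).1. Qed.

Let V0 : 0 < V.
Proof. by rewrite fine_gt0. Qed.

Let piE x : X x -> pi x = V^-1.
Proof. by move=> Xx; rewrite /pi /uniform_density indicE mem_set// mul1r. Qed.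

Let deriveE x y : X x -> 0 <= y -> derive_Rplus (d x) y = derive_Rplus g y.
Proof.
move=> Xx y0; rewrite /derive_Rplus; congr (lim _).
have h z : Rplus z -> diff_quotient (d x) y z = diff_quotient g y z.
  by move=> z0; rewrite /diff_quotient !(d_homogeneous x x0).
apply/seteqP; split => A; rewrite /nbhs/= /within/=; apply: filterS => z H z0.
  by move: (H z0); rewrite /= h.
by move: (H z0); rewrite /= h.
Qed.

Let rateE x y : X x -> 0 <= y -> rate pi d x y = V^-1 * derive_Rplus g y.
Proof. by move=> Xx y0; rewrite /rate piE// deriveE. Qed.

Let rate_invE x l : X x -> rate_inv pi d x l = rate_inv pi d x0 l.
Proof.
move=> Xx; rewrite /rate_inv !rateE//; case: ifP => // _; congr xget.
by apply/seteqP; split => y [y0 <-]; split => //; rewrite !rateE.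
Qed.

Let phiE x t : X x -> phi x t = phi x0 t.
Proof. by move=> Xx; rewrite /phi /optimal_plan; case: ifP => // _; exact: rate_invE. Qed.

Let int_cst r : (\int[@lebesgue_Rn R n]_(x in X) r%:E = (r * V)%:E)%E.
Proof. by have := @integral_cst _ _ _ (@lebesgue_Rn R n) X X_measurable r%:E; rewrite /cst => ->; rewrite EFinM -V_E. Qed.

Let detectE (t : R) : 0 <= phi x0 t ->
  (subjective_detection X pi d (phi ^~ t) = true_detection x0 d (phi ^~ t)).
Proof.
move=> p0; rewrite /subjective_detection /true_detection.
rewrite (eq_integral (cst (g (phi x0 t) / V)%:E)); last first.
  move=> x /[!inE] Xx /=; rewrite piE// phiE//.
  by rewrite (d_homogeneous x x0).
by rewrite int_cst mulfVK// gt_eqF.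
Qed.

Let g01 y : Rplus y -> 0 <= g y <= 1. Proof. by move=> y0; exact: d_detection. Qed.

Let rate_inv_ge0 x l : 0 <= rate_inv pi d x l.
Proof.
rewrite /rate_inv; case: ifP => // _.
by case: xgetP => [y _ [] | //].
Qed.

Let phi_ge0 x t : 0 <= phi x t.
Proof. by rewrite /phi /optimal_plan; case: ifP. Qed.

Let phi_val t : Rplus t -> phi x0 t = E t / V.
Proof.
move=> t0; have [Epos _ _] := E_effort.
have [_ gd gc gp gs] := d_regular x0 X_x0.
rewrite /phi /optimal_plan; case: eqVneq => [->|E0]; first by rewrite mul0r.
have Et : 0 < E t by rewrite lt_neqAle eq_sym E0; exact: Epos.
have Q l : total_rate_inv X pi d l = (rate_inv pi d x0 l * V)%:E.
  rewrite -int_cst; apply: eq_integral => x /[!inE] Xx; by rewrite rate_invE.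
suff : total_rate_inv X pi d (multiplier X pi d (E t)) = (E t)%:E.
  by rewrite Q => -[EtE]; rewrite -[in RHS]EtE mulfK// gt_eqF.
rewrite /multiplier; case: xgetP => [l _ []//|]/=.
pose y := E t / V; have y0 : 0 < y by rewrite divr_gt0.
move=> /(_ (rate pi d x0 y)); case; split.
  by rewrite rateE ?mulr_gt0 ?invr_gt0 ?(ltW y0)//; exact/gp/ltW.
rewrite Q /rate_inv ifT; last first.
  rewrite !rateE ?lexx ?(ltW y0)// ler_pM2l ?invr_gt0//.
  apply/ltW/gs => //; [exact: lexx|exact: ltW].
rewrite (@xget_unique _ _ _ y).
- by rewrite /y mulfVK// gt_eqF.
- by split => //; exact: ltW.
have Vn0 : V^-1 != 0 by rewrite gt_eqF// invr_gt0.
move=> z [z0]; rewrite !rateE ?(ltW y0)// => /(mulfI Vn0).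
apply: (derive_Rplus_inj _ g gs) => //; exact: ltW.
Qed.

(* The plan given by the formula is uniformly optimal within Phi(E). *)
Lemma optimal_plan_uniformly_optimal : uniformly_optimal X pi d E phi.
Proof.
have [Epos Em _] := E_effort.
have [_ gd gc gp gs] := d_regular x0 X_x0.
split.
  split; last first.
    move=> t t0; rewrite (eq_integral (cst (phi x0 t)%:E)); last first.
      by move=> x /[!inE] Xx; rewrite phiE.
    by rewrite int_cst phi_val// mulfVK// gt_eqF.
  split => [t t0|x s t Xx s0 t0 st]; last first.
    by rewrite !phiE// !phi_val// ler_wpM2r ?invr_ge0 ?(ltW V0)//; exact: Em.
  split => [x _|]; first exact: phi_ge0.
  apply: (@eq_integrable _ _ _ (@lebesgue_Rn R n) _ _ (cst (phi x0 t)%:E)) => //.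
    by move=> x /[!inE] Xx /=; rewrite phiE.
  apply/integrableP; split => //; rewrite integral_cst//= V_E lte_mul_pinfty//.
  exact: ltry.
move=> t psi t0 [[psia _] psiE]; have [psi0 psiI] := psia t t0.
rewrite (detectE t (phi_ge0 _ _)) /true_detection.
pose c := phi x0 t; have c0 : 0 <= c by exact: phi_ge0.
pose D := derive_Rplus g c; have D0 : 0 < D by exact: gp.
have gD : 0 <= g c - D * c.
  have := le_tangent _ g gd gp gs 0 c (lexx 0) c0; rewrite -/D.
  have := g01 0 (lexx 0); lra.
have mpsi : measurable_fun X (psi ^~ t).
  by apply/measurable_EFinP; exact: measurable_int psiI.
apply: (@le_trans _ _ (\int[@lebesgue_Rn R n]_(x in X)
    ((V^-1 * (g c - D * c))%R%:E + (V^-1 * D)%R%:E * (psi x t)%:E)))%E.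
  apply: ge0_le_integral => //.
  - by move=> x Xx; rewrite lee_fin piE// mulr_ge0 ?invr_ge0 ?(ltW V0)//; have /andP[] := d_detection x (psi x t) Xx (psi0 x Xx).
  - apply/measurable_EFinP.
    apply: (eq_measurable_fun ((g \o (psi ^~ t)) \* cst V^-1)).
      move=> x /[!inE] Xx /=; rewrite piE//; congr (_ * _).
      by apply: d_homogeneous => //; exact: psi0.
    apply: measurable_funM => //; apply: (@measurable_comp _ _ _ _ _ _ (@Rplus R)) => //.
    + have -> : @Rplus R = `[0, +oo[%classic.
        by apply/seteqP; split => x; rewrite /Rplus/= in_itv/= andbT.
      exact: measurable_itv.
    + by move=> _ [x Xx <-]; exact: psi0.
    + exact: measurable_Rplus_g.
  - apply/measurable_EFinP; apply: measurable_funD => //.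
    exact: measurable_funM.
  - move=> x Xx; rewrite -EFinM -EFinD lee_fin piE//.
    rewrite (d_homogeneous x x0)//; last exact: psi0.
    rewrite mulrC -mulrA -mulrDr ler_wpM2l ?invr_ge0 ?(ltW V0)//.
    apply: le_trans (le_tangent _ g gd gp gs (psi x t) c (psi0 x Xx) c0) _.
    by rewrite -/D mulrBr; lra.
rewrite ge0_integralD//.
- rewrite int_cst ge0_integralZl_EFin//.
  + rewrite psiE// -EFinM -EFinD lee_fin.
    have -> : E t = c * V by rewrite /c phi_val// mulfVK// gt_eqF.
    rewrite le_eqVlt; apply/orP; left; apply/eqP.
    rewrite -/g -/c; field; by rewrite gt_eqF.
  + exact/measurable_EFinP.
  + by rewrite mulr_ge0// ?invr_ge0 ltW.
- by move=> x _; rewrite lee_fin mulr_ge0// invr_ge0 ltW.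
- by move=> x Xx; rewrite -EFinM lee_fin mulr_ge0 ?psi0// mulr_ge0 ?invr_ge0 ?ltW.
- by apply/measurable_EFinP; exact: measurable_funM.
Qed.
End optimal_plan_optimal.

(* Main.v *)
Require Import Defs.
From mathcomp Require Import all_boot all_order all_algebra.
From mathcomp Require Import all_classical all_reals all_analysis.

Import Order.TTheory GRing.Theory Num.Theory.
Import numFieldNormedType.Exports.

Local Open Scope classical_set_scope.
Local Open Scope ring_scope.

(** For a uniform target distribution and a homogeneous detection function, the
rate [q_x(y) = pi(x) * dd(x, y)/dy] does not depend on [x] in [X]
([rate_uniform]). Hence neither does [q_x^-1], nor the plan [phi( ., t)], which
spreads the effort evenly over [X] ([optimal_plan_uniform]). The probability of
detecting the target at [x] under this plan is thus the same for all [x] in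
[X]; averaging it over [X] gives its value at [x0]
([subjective_detection_uniform]). The equality of the mean times to detection
follows by integrating over time. *)

Lemma uniform_densityE (R : realType) (n : nat) (X : set (Rn R n)) (x : Rn R n) :
  X x -> uniform_density X x = (fine (lebesgue_Rn X))^-1.
Proof. by move=> Xx; rewrite /uniform_density indicE mem_set// mul1r. Qed.

(** The derivative on [Rplus] only depends on the values on [Rplus]. *)
Lemma eq_derive_Rplus (R : realType) (g h : R -> R) (y : R) : 0 <= y ->
  (forall z, 0 <= z -> g z = h z) -> derive_Rplus g y = derive_Rplus h y.
Proof.
move=> y0 gh; rewrite /derive_Rplus; congr (lim _).
have ghq : \forall z \near within (@Rplus R) (dnbhs y),
    diff_quotient g y z = diff_quotient h y z.
  rewrite near_withinE; apply: nearW => z z0.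
  by rewrite /diff_quotient !gh.
apply/seteqP; split; apply: near_eq_cvg => //.
by apply: filterS ghq => z ->.
Qed.

Section uniform_homogeneous.
Context (R : realType) (n : nat) (X : set (Rn R n)) (d : Rn R n -> R -> R).
Hypothesis d_homogeneous : homogeneous X d.
Let pi := uniform_density X.

Lemma rate_uniform x x' y : X x -> X x' -> 0 <= y ->
  rate pi d x y = rate pi d x' y.
Proof.
move=> Xx Xx' y0; rewrite /rate /pi !uniform_densityE//; congr (_ * _).
by apply: eq_derive_Rplus => // z z0; exact: d_homogeneous.
Qed.

Lemma rate_inv_uniform x x' l : X x -> X x' ->
  rate_inv pi d x l = rate_inv pi d x' l.
Proof.
move=> Xx Xx'; rewrite /rate_inv (rate_uniform x x' 0)//.
case: ifP => // _; congr xget; apply/seteqP.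
by split=> y [y0 <-]; split=> //; exact: rate_uniform.
Qed.

Lemma optimal_plan_uniform E x x' t : X x -> X x' ->
  optimal_plan X pi d E x t = optimal_plan X pi d E x' t.
Proof.
by move=> Xx Xx'; rewrite /optimal_plan; case: ifP => // _; exact: rate_inv_uniform.
Qed.

(** An allocation that is constant on [X] has the same subjective and true
probabilities of detection. *)
Lemma subjective_detection_uniform x0 (f : Rn R n -> R) :
  measurable X -> (0 < lebesgue_Rn X < +oo)%E -> X x0 -> 0 <= f x0 ->
  (forall x, X x -> f x = f x0) ->
  subjective_detection X pi d f = true_detection x0 d f.
Proof.
move=> mX /andP[X0 Xoo] Xx0 fx0 fE.
rewrite /subjective_detection /true_detection.
set V := fine (lebesgue_Rn X).
have V_neq0 : V != 0 by rewrite gt_eqF// fine_gt0// X0.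
rewrite (eq_integral (cst (d x0 (f x0) / V)%:E)); last first.
  move=> x /[!inE] Xx; rewrite /= /pi uniform_densityE// fE//.
  by rewrite (d_homogeneous x x0).
rewrite integral_cst//= -[X in (_ * X)%E]fineK; last first.
  by rewrite ge0_fin_numE// ltW.
by rewrite -EFinM mulfVK.
Qed.

End uniform_homogeneous.

Lemma rate_inv_ge0 (R : realType) (n : nat) pi (d : Rn R n -> R -> R) x l :
  0 <= rate_inv pi d x l.
Proof. by rewrite /rate_inv; case: ifP => // _; case: xgetP => // y _ []. Qed.

Lemma optimal_plan_ge0 (R : realType) (n : nat) (X : set (Rn R n)) pi d E x t :
  0 <= optimal_plan X pi d E x t.
Proof. by rewrite /optimal_plan; case: ifP => // _; exact: rate_inv_ge0. Qed.

Theorem theorem3p2 (R : realType) (n : nat) (X : set (Rn R n)) (x0 : Rn R n)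
    (d : Rn R n -> R -> R) (E : R -> R)
    (X_measurable : measurable X) (X_bounded : bounded_set X)
    (X_uncountable : ~ countable X)
    (X_volume : (0 < lebesgue_Rn X < +oo)%E)
    (X_x0 : X x0)
    (E_effort : cumulative_effort E)
    (d_detection : detection_function X d)
    (d_regular : regular X d) (d_homogeneous : homogeneous X d) :
  let pi := uniform_density X in
  let phi := optimal_plan X pi d E in
  (forall t : R, 0 <= t ->
     subjective_detection X pi d (phi ^~ t) = true_detection x0 d (phi ^~ t)) /\
  subjective_mean_time X pi d phi = true_mean_time x0 d phi.
Proof.
move=> pi phi.
have detectE t : subjective_detection X pi d (phi ^~ t) =
    true_detection x0 d (phi ^~ t).
  apply: subjective_detection_uniform => //; first exact: optimal_plan_ge0.
  by move=> x Xx; exact: optimal_plan_uniform.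
split=> [t _|]; first exact: detectE.
by apply: eq_integral => t _; rewrite detectE.
Qed.
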